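(* Let $p,q$ be two integers and let $n$ be a positive integer. Then the generalized Fibonacci-Lucas quaternion $G^{p,q}_n=g^{p,q}_n+g^{p,q}_{n+1}i+g^{p,q}_{n+2}j+g^{p,q}_{n+3}k$ is a zero divisor in the quaternion ring $\mathbb{H}_{\mathbb{Z}_3}(-1,-1)$.
   Context: $(f_n)_{n\ge 0}$ is the Fibonacci sequence ($f_0=0$, $f_1=1$, $f_n=f_{n-1}+f_{n-2}$ for $n\ge2$) and $(l_n)_{n\ge 0}$ the Lucas sequence ($l_0=2$, $l_1=1$, $l_n=l_{n-1}+l_{n-2}$ for $n\ge2$). For integers $p,q$ the generalized Fibonacci-Lucas numbers are $g^{p,q}_{n+1}=p f_n+q\, l_{n+1}$, $n\ge 0$. For a prime $r$, $\mathbb{Z}_r=\mathbb{Z}/r\mathbb{Z}$, and $\mathbb{H}_{\mathbb{Z}_r}(-1,-1)$ is the 4-dimensional associative unital $\mathbb{Z}_r$-algebra with basis $\{1,i,j,k\}$ and relations $i^2=j^2=-1$, $k=ij=-ji$. Integer coefficients are reduced modulo $r$. An element $x$ of a ring is a zero divisor if there is a nonzero $y$ with $xy=0$ or $yx=0$ (so $0$ counts as a zero divisor). *)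

(* Defs.v *)
From HB Require Import structures.
From mathcomp Require Import all_boot all_order all_algebra.
From mathcomp Require Import ring.

Set Implicit Arguments.
Unset Strict Implicit.
Unset Printing Implicit Defensive.

Import GRing.Theory.
Local Open Scope ring_scope.

Fixpoint fib (n : nat) : nat :=
  if n is m.+1 then (if m is m'.+1 then fib m + fib m' else 1)%N else 0%N.

Fixpoint lucas (n : nat) : nat :=
  if n is m.+1 then (if m is m'.+1 then lucas m + lucas m' else 1)%N else 2%N.

(* g^{p,q}_n, with the index shifted: g_{n+1} = p f_n + q l_{n+1}.  The value
   at n = 0 is a junk value (there 0.-1 = 0); see genFLS. *)
Definition genFL (p q : int) (n : nat) : int :=
  p * (fib n.-1)%:Z + q * (lucas n)%:Z.

Lemma genFLS (p q : int) (n : nat) :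
  genFL p q n.+1 = p * (fib n)%:Z + q * (lucas n.+1)%:Z.
Proof. by []. Qed.

(* The quaternion algebra H_R(a, b): elements are stored by their coordinates
   in the basis 1, i, j, k, where i^2 = a, j^2 = b and k = ij = - ji. *)
Record quat (R : comNzRingType) (a b : R) : Type := Quat {
  quat1 : R;
  quati : R;
  quatj : R;
  quatk : R
}.

Section QuatAlgebra.
Variables (R : comNzRingType) (a b : R).
Local Notation H := (quat a b).
Local Notation Q := (@Quat R a b).
Implicit Types x y z : H.

Definition quat_to_prod x : R * R * R * R :=
  (quat1 x, quati x, quatj x, quatk x).
Definition quat_of_prod (u : R * R * R * R) : H :=
  let: (u1, ui, uj, uk) := u in Q u1 ui uj uk.
Lemma quat_to_prodK : cancel quat_to_prod quat_of_prod.
Proof. by case. Qed.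

HB.instance Definition _ := Choice.copy H (can_type quat_to_prodK).

Definition quat_zero : H := Q 0 0 0 0.
Definition quat_opp x : H :=
  Q (- quat1 x) (- quati x) (- quatj x) (- quatk x).
Definition quat_add x y : H :=
  Q (quat1 x + quat1 y) (quati x + quati y)
    (quatj x + quatj y) (quatk x + quatk y).

Lemma quat_addA : associative quat_add.
Proof. by move=> x y z; rewrite /quat_add /= !addrA. Qed.
Lemma quat_addC : commutative quat_add.
Proof.
by move=> x y; congr Quat; rewrite addrC.
Qed.
Lemma quat_add0 : left_id quat_zero quat_add.
Proof. by case=> *; rewrite /quat_add /= !add0r. Qed.
Lemma quat_addN : left_inverse quat_zero quat_opp quat_add.
Proof. by case=> *; rewrite /quat_add /= !addNr. Qed.

HB.instance Definition _ :=
  GRing.isZmodule.Build H quat_addA quat_addC quat_add0 quat_addN.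

Definition quat_one : H := Q 1 0 0 0.

(* Bilinear extension of the multiplication table
   i^2 = a, j^2 = b, k^2 = - ab, ij = k, ji = - k,
   ik = aj, ki = - aj, kj = bi, jk = - bi. *)
Definition quat_mul x y : H :=
  let: Quat x1 xi xj xk := x in
  let: Quat y1 yi yj yk := y in
  Q (x1 * y1 + a * (xi * yi) + b * (xj * yj) - a * b * (xk * yk))
    (x1 * yi + xi * y1 - b * (xj * yk) + b * (xk * yj))
    (x1 * yj + xj * y1 + a * (xi * yk) - a * (xk * yi))
    (x1 * yk + xk * y1 + xi * yj - xj * yi).

Lemma quat_mulA : associative quat_mul.
Proof. by case=> ? ? ? ? [? ? ? ?] [? ? ? ?]; congr Quat => /=; ring. Qed.
Lemma quat_mul1q : left_id quat_one quat_mul.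
Proof. by case=> ? ? ? ?; congr Quat => /=; ring. Qed.
Lemma quat_mulq1 : right_id quat_one quat_mul.
Proof. by case=> ? ? ? ?; congr Quat => /=; ring. Qed.
Lemma quat_mulDl : left_distributive quat_mul +%R.
Proof. by case=> ? ? ? ? [? ? ? ?] [? ? ? ?]; congr Quat => /=; ring. Qed.
Lemma quat_mulDr : right_distributive quat_mul +%R.
Proof. by case=> ? ? ? ? [? ? ? ?] [? ? ? ?]; congr Quat => /=; ring. Qed.
Lemma quat_one_neq0 : quat_one != 0.
Proof. by apply/eqP => -[/eqP]; rewrite oner_eq0. Qed.

HB.instance Definition _ := GRing.Zmodule_isNzRing.Build H
  quat_mulA quat_mul1q quat_mulq1 quat_mulDl quat_mulDr quat_one_neq0.

Definition quat_scale (c : R) x : H :=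
  Q (c * quat1 x) (c * quati x) (c * quatj x) (c * quatk x).

Lemma quat_scaleA c d x :
  quat_scale c (quat_scale d x) = quat_scale (c * d) x.
Proof. by congr Quat => /=; rewrite mulrA. Qed.
Lemma quat_scale1 : left_id 1 quat_scale.
Proof. by case=> ? ? ? ?; congr Quat => /=; rewrite mul1r. Qed.
Lemma quat_scaleDr : right_distributive quat_scale +%R.
Proof. by move=> c x y; congr Quat => /=; rewrite mulrDr. Qed.
Lemma quat_scaleDl x : {morph quat_scale^~ x : c d / c + d}.
Proof. by move=> c d; congr Quat => /=; rewrite mulrDl. Qed.

HB.instance Definition _ := GRing.Zmodule_isLmodule.Build R H
  quat_scaleA quat_scale1 quat_scaleDr quat_scaleDl.

Lemma quat_scaleAl (c : R) x y : c *: (x * y) = (c *: x) * y.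
Proof.
by case: x y => ? ? ? ? [? ? ? ?]; congr Quat => /=; ring.
Qed.
HB.instance Definition _ := GRing.Lmodule_isLalgebra.Build R H quat_scaleAl.

Lemma quat_scaleAr (c : R) x y : c *: (x * y) = x * (c *: y).
Proof.
by case: x y => ? ? ? ? [? ? ? ?]; congr Quat => /=; ring.
Qed.
HB.instance Definition _ := GRing.Lalgebra_isAlgebra.Build R H quat_scaleAr.

Definition qi : H := Q 0 1 0 0.
Definition qj : H := Q 0 0 1 0.
Definition qk : H := Q 0 0 0 1.

Lemma qiqi : qi * qi = a%:A.
Proof. by congr Quat => /=; ring. Qed.
Lemma qjqj : qj * qj = b%:A.
Proof. by congr Quat => /=; ring. Qed.
Lemma qiqj : qi * qj = qk.
Proof. by congr Quat => /=; ring. Qed.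
Lemma qjqi : qj * qi = - qk.
Proof. by congr Quat => /=; ring. Qed.

Lemma quat_coordE (c1 ci cj ck : R) :
  c1%:A + ci *: qi + cj *: qj + ck *: qk = Q c1 ci cj ck.
Proof. by congr Quat => /=; ring. Qed.

Lemma quat_basis x :
  exists! c : R * R * R * R,
    x = c.1.1.1%:A + c.1.1.2 *: qi + c.1.2 *: qj + c.2 *: qk.
Proof.
exists (quat_to_prod x); split=> [|[[[c1 ci] cj] ck]] /=.
  by rewrite quat_coordE; case: x.
by rewrite quat_coordE => ->.
Qed.

(* G^{p,q}_n, with its integer coefficients mapped into R. *)
Definition genFLquat (p q : int) (n : nat) : H :=
  (genFL p q n)%:~R%:A + (genFL p q n.+1)%:~R *: qi
    + (genFL p q n.+2)%:~R *: qj + (genFL p q n.+3)%:~R *: qk.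

End QuatAlgebra.

Definition zero_divisor (A : nzRingType) (x : A) : Prop :=
  exists2 y : A, y != 0 & x * y = 0 \/ y * x = 0.

(* Main.v *)
Require Import Defs.
From mathcomp Require Import all_boot all_order all_algebra.
From mathcomp Require Import ring.

Set Implicit Arguments.
Unset Strict Implicit.
Unset Printing Implicit Defensive.

Import GRing.Theory.

Local Open Scope ring_scope.

(** In a quaternion algebra the product of [x] and its conjugate is the scalar
    [N x], where [N] is the reduced norm; so a quaternion of reduced norm zero
    is a zero divisor ([quat_norm0_zero_divisor]).  For [a = b = -1] the norm
    is the sum of the four squared coordinates.

    The generalized Fibonacci-Lucas numbers satisfy the Fibonacci recurrence
    from index [1] on, so the coordinates of the quaternion of index [n] are
    [u], [v], [u + v] and [u + 2 v] for integers [u] and [v].  Its norm is then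
    [u ^ 2 + v ^ 2 + (u + v) ^ 2 + (u + 2 v) ^ 2
     = 3 (u ^ 2 + 2 u v + 2 v ^ 2)], which vanishes modulo 3. *)

Definition quat_conj (R : comNzRingType) (a b : R) (x : quat a b) : quat a b :=
  Quat a b (quat1 x) (- quati x) (- quatj x) (- quatk x).

Definition quat_norm (R : comNzRingType) (a b : R) (x : quat a b) : R :=
  quat1 x ^+ 2 - a * quati x ^+ 2 - b * quatj x ^+ 2 + a * b * quatk x ^+ 2.

Lemma quat_mul_conj (R : comNzRingType) (a b : R) (x : quat a b) :
  x * quat_conj x = (quat_norm x)%:A.
Proof.
by case: x => x1 xi xj xk; congr Quat; rewrite /quat_norm /=; ring.
Qed.

Lemma quat_conj_eq0 (R : comNzRingType) (a b : R) (x : quat a b) :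
  quat_conj x = 0 -> x = 0.
Proof.
case: x => x1 xi xj xk [-> hi hj hk].
by congr Quat; apply: oppr_inj; rewrite oppr0.
Qed.

(** The conjugate is the annihilating partner, except for [x = 0], where it
    vanishes and [1] takes its place. *)
Lemma quat_norm0_zero_divisor (R : comNzRingType) (a b : R) (x : quat a b) :
  quat_norm x = 0 -> zero_divisor x.
Proof.
move=> Nx0; have [/quat_conj_eq0 -> | xc_neq0] := eqVneq (quat_conj x) 0.
  by exists 1; [exact: oner_neq0 | left; rewrite mul0r].
by exists (quat_conj x) => //; left; rewrite quat_mul_conj Nx0 scale0r.
Qed.

(** The recurrence starts at index [1]: the value of [genFL] at [0] is not the
    one that the recurrence would give backwards. *)
Lemma genFL_rec (p q : int) (n : nat) : (0 < n)%N ->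
  genFL p q n.+2 = genFL p q n.+1 + genFL p q n.
Proof.
case: n => // n _; rewrite !genFLS.
have -> : fib n.+2 = (fib n.+1 + fib n)%N by [].
have -> : lucas n.+3 = (lucas n.+2 + lucas n.+1)%N by [].
by rewrite !PoszD; ring.
Qed.

Lemma quat_norm_genFLquat (R : comNzRingType) (p q : int) (n : nat) :
  (0 < n)%N ->
  quat_norm (genFLquat (-1 : R) (-1 : R) p q n) =
  3%:R * ((genFL p q n)%:~R ^+ 2
          + 2%:R * ((genFL p q n)%:~R * (genFL p q n.+1)%:~R)
          + 2%:R * (genFL p q n.+1)%:~R ^+ 2).
Proof.
move=> n_gt0; rewrite /genFLquat quat_coordE /quat_norm /=.
rewrite (@genFL_rec p q n.+1) // (@genFL_rec p q n) // !rmorphD /=.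
move: (_%:~R) (_%:~R) => u v; ring.
Qed.

Theorem proposition3p3 (p q : int) (n : nat) (hn : (0 < n)%N) :
  zero_divisor (genFLquat (-1 : 'F_3) (-1 : 'F_3) p q n).
Proof.
apply: quat_norm0_zero_divisor; rewrite quat_norm_genFLquat //.
by rewrite (pcharf0 (pchar_Fp (isT : prime 3))) mul0r.
Qed.
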